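(* Let $R$ be the endomorphism ring of an elliptic curve, let $H$ be a finite subgroup of $GL(2,R)$ with $$H\cap SL(2,R)=\langle -I_2\rangle\simeq C_2,$$ and let $h_o\in H$ be an element of order $r$ with $\det(H)=\langle\det(h_o)\rangle\simeq C_s$, $s>1$, and eigenvalues $\lambda_1(h_o),\lambda_2(h_o)$. Then $H$ is isomorphic to $H_{C2}(i)$ for some $1\leq i\leq7$, where $$H_{C2}(1)=\langle iI_2\rangle\simeq C_4\ \text{ with }\ R=\mathbb{Z}[i],$$ $$H_{C2}(2)=\langle -I_2\rangle\times\langle h_o\rangle\simeq C_2\times C_2\ \text{ with }\ \lambda_1(h_o)=1,\ \lambda_2(h_o)=-1,$$ $$H_{C2}(3)=\langle h_o\rangle\simeq C_6\ \text{ with }\ R=\mathcal{O}_{-3},\ h_o=e^{\frac{\pi i}{3}}I_2\ \text{ or }\ \lambda_1(h_o)=e^{-\frac{\pi i}{3}},\ \lambda_2(h_o)=-1,$$ $$H_{C2}(4)=\langle h_o\rangle\simeq C_8\ \text{ with }\ R=\mathbb{Z}[i],\ \lambda_1(h_o)=e^{\frac{3\pi i}{4}},\ \lambda_2(h_o)=e^{-\frac{\pi i}{4}},$$ $$H_{C2}(5)=\langle -I_2\rangle\times\langle h_o\rangle\simeq C_2\times C_4\ \text{ with }\ R=\mathbb{Z}[i],\ \lambda_1(h_o)=i,\ \lambda_2(h_o)=1,$$ $$H_{C2}(6)=\langle h_o\rangle\simeq C_8\ \text{ with }\ R=\mathbb{Z}[i],\ \lambda_1(h_o)=e^{\frac{3\pi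 i}{4}},\ \lambda_2(h_o)=e^{-\frac{\pi i}{4}},$$ $$H_{C2}(7)=\langle -I_2\rangle\times\langle h_o\rangle\simeq C_2\times C_6\ \text{ with }\ R=\mathcal{O}_{-3},$$ $$\{\lambda_1(h_o),\lambda_2(h_o)\}=\{e^{\frac{2\pi i}{3}},e^{-\frac{\pi i}{3}}\},\ \{e^{\frac{\pi i}{3}},1\}\ \text{ or }\ \{e^{-\frac{2\pi i}{3}},-1\}.$$
   Context: $R=\mathrm{End}(E)$ for a complex elliptic curve $E$; thus $R=\mathbb{Z}$ or $R=\mathbb{Z}+f\mathcal{O}_{-d}\subset\mathbb{C}$ with $f\in\mathbb{N}$ and $\mathcal{O}_{-d}$ the integers ring of an imaginary quadratic field $\mathbb{Q}(\sqrt{-d})$. $GL(2,R)=\{g\in R_{2\times2}:\det(g)\in R^*\}$, $SL(2,R)$ is its subgroup of matrices of determinant $1$, and $C_n$ is the cyclic group of order $n$. In the list, $h_o$ denotes some element of $GL(2,R)$ with the indicated properties; ''with $R=\dots$'' means that the case is listed only for that ring $R$. *)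

(* Defs.v *)
(* The complex numbers are F[i] for F : realType, the field of real numbers. *)
From HB Require Import structures.
From mathcomp Require Import all_boot all_order all_algebra all_fingroup.
From mathcomp Require Import boolp classical_sets functions cardinality reals.
From mathcomp Require Import normedtype trigo.
From mathcomp Require Import complex.

Set Implicit Arguments.
Unset Strict Implicit.
Unset Printing Implicit Defensive.

Import Order.TTheory GRing.Theory Num.Theory.

Local Open Scope classical_set_scope.
Local Open Scope ring_scope.

(* Groups of units of a ring T (here T is the complex numbers or the 2 x 2
   complex matrices), as subsets of T under the ring multiplication. *)
Section UnitGroups.
Variable T : unitRingType.
Implicit Types (A B G : set T) (x y : T).

Definition is_subgroup A B : Prop :=
  [/\ A `<=` B, A `<=` [set x | x \is a GRing.unit], A 1,
      forall x y, A x -> A y -> A (x * y) & forall x, A x -> A x^-1].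

(* Integer powers; meant for x a unit. *)
Definition cyc x : set T := [set x ^ k | k in [set: int]].

Definition is_dprod A B G : Prop :=
  [/\ A `&` B = [set 1], forall x y, A x -> B y -> x * y = y * x
    & G = [set x * y | x in A & y in B]].

Definition isomorphic A B : Prop :=
  exists f : T -> T,
    set_bij A B f /\ forall x y, A x -> A y -> f (x * y) = f x * f y.

Definition isomorphic_to_fin (gT : finGroupType) (K : {set gT}) A : Prop :=
  exists f : gT -> T,
    set_bij [set u | u \in K] A f /\
    forall u v, u \in K -> v \in K -> f (u * v)%g = f u * f v.

(* Zp n is the cyclic group of order n for every n > 0; the full type 'Z_n has
   n elements only for n > 1. *)
Definition isoC (n : nat) A : Prop := isomorphic_to_fin (Zp n) A.

Definition isoCxC (m n : nat) A : Prop :=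
  isomorphic_to_fin (finset.setX (Zp m) (Zp n)) A.

End UnitGroups.

Section EllipticOrders.
Variable F : realType.
Local Notation C := (F[i]).
Implicit Types (R L : set C) (w z : C).

Definition lattice (w1 w2 : C) : set C :=
  [set z | exists m n : int, z = m%:~R * w1 + n%:~R * w2].

(* The complex elliptic curve is the torus C / lattice w1 w2; its endomorphisms
   are induced by the multiplications by z that preserve the lattice, so its
   endomorphism ring is a subring of C. *)
Definition is_elliptic_End R : Prop :=
  exists w1 w2 : C,
    (forall a b : F, a%:C%C * w1 + b%:C%C * w2 = 0 -> a = 0 /\ b = 0) /\
    R = [set z | forall l, lattice w1 w2 l -> lattice w1 w2 (z * l)].

Definition gaussian_integers : set C :=
  [set z | exists a b : int, z = a%:~R + b%:~R * 'i%C].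

(* The integers ring of the field Q(sqrt (-d)). *)
Definition quad_integers (d : nat) : set C :=
  [set z | (exists a b : rat, z = ratr a + ratr b * sqrtC (- d%:R)) /\
           integralOver (intr : int -> C) z].

Definition units_in R : set C :=
  [set x | R x /\ exists2 y, R y & x * y = 1].

Definition GL2 R : set 'M[C]_2 :=
  [set g : 'M[C]_2 |
  (forall i j, R (g i j)) /\ units_in R (\det g)].

Definition SL2 R : set 'M[C]_2 := [set g : 'M[C]_2 | GL2 R g /\ \det g = 1].

(* The eigenvalues of g, counted with multiplicity, are a and b. *)
Definition eigenvalues2 (g : 'M[C]_2) (a b : C) : Prop :=
  char_poly g = ('X - a%:P) * ('X - b%:P).

(* cis t is exp (t * 'i). *)
Definition cis (t : F) : C := (cos t +i* sin t)%C.

(* HC2 R k G : the subgroup G of GL(2, R) is a group H_{C2}(k), 1 <= k <= 7. *)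
Definition HC2 R (k : nat) (G : set 'M[C]_2) : Prop :=
  match k with
  | 1 => [/\ R = gaussian_integers, G = cyc ('i%C)%:M & isoC 4 G]
  | 2 => exists h,
      [/\ GL2 R h, eigenvalues2 h 1 (- 1),
          is_dprod (cyc (- 1)) (cyc h) G & isoCxC 2 2 G]
  | 3 => exists h,
      [/\ R = quad_integers 3, GL2 R h,
          h = (cis (pi / 3%:R))%:M \/
            eigenvalues2 h (cis (- (pi / 3%:R))) (- 1),
          G = cyc h & isoC 6 G]
  | 4 => exists h,
      [/\ R = gaussian_integers, GL2 R h,
          eigenvalues2 h (cis (3%:R * pi / 4%:R)) (cis (- (pi / 4%:R))),
          G = cyc h & isoC 8 G]
  | 5 => exists h,
      [/\ R = gaussian_integers, GL2 R h, eigenvalues2 h 'i%C 1,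
          is_dprod (cyc (- 1)) (cyc h) G & isoCxC 2 4 G]
  (* The list repeats k = 4 as k = 6. *)
  | 6 => exists h,
      [/\ R = gaussian_integers, GL2 R h,
          eigenvalues2 h (cis (3%:R * pi / 4%:R)) (cis (- (pi / 4%:R))),
          G = cyc h & isoC 8 G]
  | 7 => exists h,
      [/\ R = quad_integers 3, GL2 R h,
          [\/ eigenvalues2 h (cis (2%:R * pi / 3%:R)) (cis (- (pi / 3%:R))),
              eigenvalues2 h (cis (pi / 3%:R)) 1
            | eigenvalues2 h (cis (- (2%:R * pi / 3%:R))) (- 1)],
          is_dprod (cyc (- 1)) (cyc h) G & isoCxC 2 6 G]
  | _ => False
  end.

End EllipticOrders.

(* Main.v *)
Require Import Defs.
From HB Require Import structures.
From mathcomp Require Import all_boot all_order all_algebra all_fingroup.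
From mathcomp Require Import boolp classical_sets functions cardinality reals.
From mathcomp Require Import normedtype trigo.
From mathcomp Require Import complex.
From mathcomp Require Import ring lra zify.

Set Implicit Arguments.
Unset Strict Implicit.
Unset Printing Implicit Defensive.

Import Order.TTheory GRing.Theory Num.Theory.

Local Open Scope classical_set_scope.
Local Open Scope ring_scope.

(** Every z in R multiplies the period lattice into itself, so it is a root of
    the characteristic polynomial of an integer 2 x 2 matrix; hence z + z^* and
    z * z^* are integers ([elliptic_End_trace_norm]).  For the root of unity
    det ho this leaves |z + z^*| <= 2, so det ho, which is not 1 because s > 1,
    has order e = 2, 3, 4 or 6 ([root_of_unity_quadratic]).  The same
    integrality shows that R contains a square root of -1 only if R = Z[i]
    ([eq_gaussian_integers]) and a primitive cube root of unity only if
    R = O_{-3} ([eq_quad_integers_3]).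

    The kernel of det on H is {1, -1}, so the elements of H are the powers of
    ho and their opposites, and ho ^+ e = 1 or -1.  If ho ^+ e = -1, then -1 is
    a power of ho and H = <ho> is cyclic of order 2e ([isoC_subgroup]).  If
    ho ^+ e = 1, then -1 is not a power of ho and H = <-1> x <ho> is isomorphic
    to C_2 x C_e ([isoCxC_subgroup]).

    As H is only to be identified up to isomorphism, it remains to exhibit one
    group G of the list with the right abstract type inside GL(2, R):
    <-1> x <diag(a, 1)> with a of order e gives C_2 x C_e ([dprod_model]); the
    scalars i and exp(pi i / 3) give C_4 and C_6; a matrix of characteristic
    polynomial X^2 + i gives C_8.  For e = 3 the two alternatives are exchanged
    by replacing ho with - ho, so H is always C_6.

    Two cases need one more remark.  If e = 2 and ho ^+ 2 = -1, then the
    Cayley-Hamilton identity reads (tr ho) ho = -2, so ho is a scalar c with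
    c ^+ 2 = -1, and R = Z[i].  If e = 6 and ho ^+ 6 = -1, then this applies
    to ho ^+ 3, so R contains c together with a square root of -3; the trace t
    of their product satisfies t ^+ 2 = 12, which is impossible
    ([not_sqrN1_and_quad_3]). *)

(** * Cyclic groups of units and their direct products *)

Section UnitGroupTheory.
Variable T : unitRingType.
Implicit Types (A B D G : set T) (x y a b : T).

(** Two groups of units are compared through a common abstract model K; K is a
    group so that products in A can be pulled back to K. *)
Lemma isomorphic_of_fin (gT : finGroupType) (K : {group gT}) A B :
  isomorphic_to_fin K A -> isomorphic_to_fin K B -> isomorphic A B.
Proof.
move=> [f [[fA f_inj f_surj] fM]] [g [[gB g_inj g_surj] gM]].
pose f' x := xget 1%g [set u | u \in K /\ f u = x].
have f'P x : A x -> f' x \in K /\ f (f' x) = x.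
  move=> /f_surj[u Ku fu].
  by apply: (@xgetPex _ 1%g [set v | v \in K /\ f v = x]); exists u.
have f'K u : u \in K -> f' (f u) = u.
  by move=> Ku; have [? ?] := f'P _ (fA u Ku); apply: f_inj; rewrite // inE.
exists (g \o f'); split=> [|x y /f'P[Kx fx] /f'P[Ky fy]].
  split=> [x /f'P[] /gB// | x y | y /g_surj[u Ku gu]].
    move=> /set_mem/f'P[Kx fx] /set_mem/f'P[Ky fy] eq_g.
    by rewrite -fx -fy; congr f; apply: g_inj; rewrite // inE.
  by exists (f u); [exact: fA | rewrite /= f'K].
by rewrite /= -{1}fx -{1}fy -fM // f'K ?groupM // gM.
Qed.

Lemma expr1_unit x n : (0 < n)%N -> x ^+ n = 1 -> x \is a GRing.unit.
Proof. by move=> n_gt0 xn1; rewrite -(unitrX_pos x n_gt0) xn1 unitr1. Qed.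

Lemma cyc_exprn x k : cyc x (x ^+ k).
Proof. by exists (Posz k). Qed.

Lemma cyc_exprP x n y : (0 < n)%N -> x ^+ n = 1 ->
  cyc x y -> exists2 k, (k < n)%N & y = x ^+ k.
Proof.
move=> n_gt0 xn1 [k _ <-]; have ux := expr1_unit n_gt0 xn1.
have n_neq0 : n%:Z != 0 by rewrite eqz_nat -lt0n.
have := modz_ge0 k n_neq0; have := ltz_pmod k (n_gt0 : 0 < n%:Z).
rewrite {3}(divz_eq k n); case: (k %% n)%Z => // m lt_mn _.
exists m => //; rewrite exprzDr // -exprz_exp exprzAC.
by rewrite -exprnP xn1 exp1rz mul1r.
Qed.

Lemma prim_rootP x n : (0 < n)%N -> x ^+ n = 1 ->
  (forall k, x ^+ k = 1 -> (n %| k)%N) -> n.-primitive_root x.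
Proof.
move=> n_gt0 xn1 n_dvd; have [m prim_m m_dvd] := prim_order_exists n_gt0 xn1.
suff -> : n = m by [].
by apply/eqP; rewrite eqn_dvd m_dvd n_dvd // prim_expr_order.
Qed.

Lemma ltn_Zp n (u : 'Z_n) : (1 < n)%N -> (u < n)%N.
Proof. by move=> n_gt1; rewrite -[ltnRHS](Zp_cast n_gt1). Qed.

Lemma val_Zp_mulg n (u v : 'Z_n) :
  (1 < n)%N -> (u * v)%g = ((u + v) %% n)%N :> nat.
Proof. by move=> n_gt1; congr (_ %% _)%N; apply: Zp_cast. Qed.

Lemma isoC_cyc n x : (1 < n)%N -> n.-primitive_root x -> isoC n (cyc x).
Proof.
move=> n_gt1 prim_x; have xn1 := prim_expr_order prim_x.
exists (fun u : 'Z_n => x ^+ u); split.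
  split=> [u _|u v _ _|y /(cyc_exprP (ltnW n_gt1) xn1)[k lt_kn ->]].
  - exact: cyc_exprn.
  - move/eqP; rewrite (eq_prim_root_expr prim_x) => /eqP.
    by rewrite !modn_small ?ltn_Zp // => /val_inj.
  - by exists (inZp k); rewrite /= ?mem_Zp // Zp_cast // modn_small.
by move=> u v _ _; rewrite -exprD val_Zp_mulg // expr_mod.
Qed.

(** x'^-1 * x = y' / y lies in both factors, hence is 1. *)
Lemma is_dprod_uniq A B G x x' y y' :
    is_subgroup A [set: T] -> is_subgroup B [set: T] -> is_dprod A B G ->
    A x -> A x' -> B y -> B y' -> x * y = x' * y' -> x = x' /\ y = y'.
Proof.
move=> [_ Au _ AM AV] [_ Bu _ BM BV] [AB1 _ _] Ax Ax' By By' eq_xy.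
have ux' := Au _ Ax'; have uy := Bu _ By.
have eq1 : x'^-1 * x = y' / y.
  by rewrite -[x](mulrK uy) eq_xy !mulrA mulVr // mul1r.
have /= e1 : [set 1] (x'^-1 * x).
  by rewrite -AB1; split; [|rewrite eq1]; auto.
split; first by rewrite -[x](mulVKr ux') e1 mulr1.
by apply: esym; rewrite -[y'](mulrVK uy) -eq1 e1 mul1r.
Qed.

Lemma cyc_subgroup x n : (0 < n)%N -> x ^+ n = 1 -> is_subgroup (cyc x) [set: T].
Proof.
move=> n_gt0 xn1; have ux := expr1_unit n_gt0 xn1.
split=> //.
- by move=> _ [k _ <-] /=; apply: unitrXz.
- by exists 0.
- by move=> _ _ [k _ <-] [l _ <-]; exists (k + l); rewrite // exprzDr.
- by move=> _ [k _ <-]; exists (- k); rewrite // invr_expz.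
Qed.

Lemma isoCxC_dprod m n a b G : (1 < m)%N -> (1 < n)%N ->
  m.-primitive_root a -> n.-primitive_root b ->
  is_dprod (cyc a) (cyc b) G -> isoCxC m n G.
Proof.
move=> m_gt1 n_gt1 prim_a prim_b dG.
have am1 := prim_expr_order prim_a; have bn1 := prim_expr_order prim_b.
have [AB1 AB_comm GE] := dG.
exists (fun u : 'Z_m * 'Z_n => a ^+ u.1 * b ^+ u.2); split.
  split=> [[u v] _|[u v] [u' v'] _ _ /= eq_uv|y].
  - by rewrite GE; exists (a ^+ u); [|exists (b ^+ v)] => //; apply: cyc_exprn.
  - have [] := is_dprod_uniq (cyc_subgroup (ltnW m_gt1) am1)
      (cyc_subgroup (ltnW n_gt1) bn1) dG _ _ _ _ eq_uv; try exact: cyc_exprn.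
    move=> /eqP; rewrite (eq_prim_root_expr prim_a) => /eqP eq_u.
    move=> /eqP; rewrite (eq_prim_root_expr prim_b) => /eqP eq_v.
    move: eq_u eq_v; rewrite !modn_small ?ltn_Zp //.
    by move=> /val_inj-> /val_inj->.
  - rewrite GE => -[_ /(cyc_exprP (ltnW m_gt1) am1)[k lt_km ->]].
    move=> [_ /(cyc_exprP (ltnW n_gt1) bn1)[l lt_ln ->] <-].
    exists (inZp k, inZp l) => /=; first by rewrite !inE !mem_Zp.
    by rewrite !Zp_cast // !modn_small.
move=> [u v] [u' v'] _ _.
change (a ^+ (u * u')%g * b ^+ (v * v')%g = a ^+ u * b ^+ v * (a ^+ u' * b ^+ v')).
rewrite !val_Zp_mulg // !expr_mod // !exprD -!mulrA.
congr (_ * _); rewrite !mulrA; congr (_ * _).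
by apply: AB_comm; apply: cyc_exprn.
Qed.

Lemma is_subgroup_sub A D : is_subgroup A [set: T] -> A `<=` D -> is_subgroup A D.
Proof. by move=> [_ ? ? ? ?] AD; split. Qed.

Lemma is_dprod_subgroup A B G :
  is_subgroup A [set: T] -> is_subgroup B [set: T] -> is_dprod A B G ->
  is_subgroup G [set: T].
Proof.
move=> [_ Au A1 AM AV] [_ Bu B1 BM BV] [_ AB_comm ->]; split=> //.
- by move=> _ [x Ax [y By <-]] /=; rewrite unitrMr ?(Bu y) //; apply: Au.
- by exists 1 => //; exists 1; rewrite ?mulr1.
- move=> _ _ [x Ax [y By <-]] [x' Ax' [y' By' <-]].
  exists (x * x'); first exact: AM.
  exists (y * y'); first exact: BM.
  by rewrite !mulrA; congr (_ * _); rewrite -!mulrA (AB_comm x').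
- move=> _ [x Ax [y By <-]]; exists x^-1; first exact: AV.
  exists y^-1; first exact: BV.
  by rewrite AB_comm ?invrM //; [apply: Au | apply: Bu | apply: AV | apply: BV].
Qed.

Lemma isomorphic_isoC n A B :
  isoC n A -> isoC n B -> isomorphic A B.
Proof. exact: (@isomorphic_of_fin _ (Zp_group n)). Qed.

Lemma isomorphic_isoCxC m n A B :
  isoCxC m n A -> isoCxC m n B -> isomorphic A B.
Proof. exact: (@isomorphic_of_fin _ (setX_group (Zp_group m) (Zp_group n))). Qed.

(** How the hypothesis s > 1 is used: it excludes det ho = 1. *)
Lemma isoC_cyc1 n : isoC n (cyc (1 : T)) -> (n <= 1)%N.
Proof.
move=> [f [[f_fun f_inj _] _]]; rewrite leqNgt; apply/negP => n_gt1.
have f1 (u : 'Z_n) : f u = 1.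
  by have [|k _ <-] := f_fun u; [exact: mem_Zp | exact: exp1rz].
have /eqP : (0 : 'Z_n) = 1 by apply: f_inj; rewrite ?f1 // inE; apply: mem_Zp.
by rewrite eq_sym oner_eq0.
Qed.

End UnitGroupTheory.

(** * Matrices of size 2 *)

Section TwoByTwo.
Variable K : comNzRingType.
Implicit Types g h : 'M[K]_2.

Lemma lift01 : lift 0 0 = 1 :> 'I_2. Proof. exact: val_inj. Qed.
Lemma lift10 : lift 1 0 = 0 :> 'I_2. Proof. exact: val_inj. Qed.

Lemma det2E g : \det g = g 0 0 * g 1 1 - g 0 1 * g 1 0.
Proof.
rewrite (expand_det_row _ 0) !big_ord_recl big_ord0 addr0 /cofactor !det_mx11.
by rewrite !mxE !lift01 !lift10 /= expr0 expr1 mul1r mulN1r mulrN.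
Qed.

Lemma mulmx2E g h i j : (g * h) i j = g i 0 * h 0 j + g i 1 * h 1 j.
Proof. by rewrite mxE !big_ord_recl big_ord0 addr0 lift01. Qed.

Lemma ord2P (P : 'I_2 -> Prop) : P 0 -> P 1 -> forall i, P i.
Proof.
move=> P0 P1 [[|[|//]] lt_i2]; first by have -> : Ordinal lt_i2 = 0 by apply: val_inj.
by have -> : Ordinal lt_i2 = 1 by apply: val_inj.
Qed.

Lemma mx2P g h : g 0 0 = h 0 0 -> g 0 1 = h 0 1 -> g 1 0 = h 1 0 ->
  g 1 1 = h 1 1 -> g = h.
Proof.
by move=> e00 e01 e10 e11; apply/matrixP; apply: ord2P; apply: ord2P.
Qed.

(** The Cayley-Hamilton identity in dimension 2. *)
Lemma sqr_mx2 g : g ^+ 2 = (g 0 0 + g 1 1) *: g - (\det g)%:M.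
Proof. by rewrite det2E expr2; apply: mx2P; rewrite mulmx2E !mxE /=; ring. Qed.

Lemma det_mx2N1 : \det (-1 : 'M[K]_2) = 1.
Proof. by rewrite -scaleN1r detZ det1 mulr1 sqrrN expr1n. Qed.

Lemma det_exprn g k : \det (g ^+ k) = \det g ^+ k.
Proof. by elim: k => [|k IHk]; rewrite ?det1 // !exprS detM IHk. Qed.

End TwoByTwo.

Lemma char_poly2 (K : comNzRingType) (g : 'M[K]_2) :
  char_poly g = 'X^2 - (g 0 0 + g 1 1) *: 'X + (\det g)%:P.
Proof.
rewrite /char_poly (det2E (char_poly_mx g)) (det2E g) /char_poly_mx.
rewrite !mxE /= polyCB !polyCM -mul_polyC polyCD.
by rewrite !mulr1n !mulr0n; ring.
Qed.

(** * Groups of matrices whose elements of determinant 1 are 1 and -1 *)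

Section DetOrder.
Variable C : numFieldType.
Implicit Types g h : 'M[C]_2.

Lemma mx2N1_neq1 : (-1 : 'M[C]_2) != 1.
Proof.
apply/eqP => /matrixP/(_ 0 0); rewrite !mxE /= => /eqP.
by rewrite -subr_eq0 -opprD oppr_eq0 (pnatr_eq0 _ 2).
Qed.

Lemma prim_mx2N1 : 2.-primitive_root (-1 : 'M[C]_2).
Proof.
apply: prim_rootP => // [|k]; first by rewrite sqrrN expr1n.
rewrite -signr_odd dvdn2; case: (odd k) => //= /eqP.
by rewrite expr1 (negbTE mx2N1_neq1).
Qed.

Lemma cyc_mx2N1P g : cyc (-1) g -> g = 1 \/ g = -1.
Proof.
move=> /(cyc_exprP _ (prim_expr_order prim_mx2N1))[//|[|[|//]] _ ->].
  by left; rewrite expr0.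
by right; rewrite expr1.
Qed.

Variables (e : nat) (h : 'M[C]_2).
Hypothesis prim_det : e.-primitive_root (\det h).

Lemma det_order_dvdn k : (\det (h ^+ k) == 1) = (e %| k)%N.
Proof. by rewrite det_exprn (prim_order_dvd prim_det). Qed.

(** If h ^+ k = 1, then e divides k because of the determinant, and
    h ^+ (j * e) = (-1) ^+ j makes j = k / e even. *)
Lemma prim_expr_N1 : h ^+ e = -1 -> (2 * e).-primitive_root h.
Proof.
move=> heN1; have e_gt0 := prim_order_gt0 prim_det.
apply: prim_rootP => [||k hk1]; first by rewrite muln_gt0.
  by rewrite mulnC exprM heN1 (prim_expr_order prim_mx2N1).
have: (e %| k)%N by rewrite -det_order_dvdn hk1 det1.
case/dvdnP=> j kE; move: hk1; rewrite {}kE mulnC exprM heN1 => /eqP.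
by rewrite -(prim_order_dvd prim_mx2N1) mulnC dvdn_pmul2l.
Qed.

Lemma prim_expr_1 : h ^+ e = 1 -> e.-primitive_root h.
Proof.
move=> he1; apply: prim_rootP => // [|k hk1]; first exact: prim_order_gt0 prim_det.
by rewrite -det_order_dvdn hk1 det1.
Qed.

(** If -1 = h ^+ k, then det (-1) = 1 makes e divide k, so h ^+ k = 1; this is
    absurd.  Dimension 2 matters here, through det (-1) = 1. *)
Lemma dprod_expr_1 : h ^+ e = 1 ->
  is_dprod (cyc (-1)) (cyc h) [set x * y | x in cyc (-1) & y in cyc h].
Proof.
move=> he1; have e_gt0 := prim_order_gt0 prim_det; split=> //.
  apply/seteqP; split=> [x [/cyc_mx2N1P[->|->] //] | x ->]; last first.
    by split; exists 0.
  case/(cyc_exprP e_gt0 he1) => k _ hk; move: (hk).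
  have /dvdnP[j ->]: (e %| k)%N by rewrite -det_order_dvdn -hk det_mx2N1.
  by rewrite mulnC exprM he1 expr1n => /eqP; rewrite (negbTE mx2N1_neq1).
by move=> x y /cyc_mx2N1P[->|->] _; rewrite ?mulN1r ?mulrN1 ?mul1r ?mulr1.
Qed.

End DetOrder.

Section SubgroupsWithDet.
Variables (C : numFieldType) (H D : set 'M[C]_2) (e : nat) (h : 'M[C]_2).
Hypotheses (H_subgroup : is_subgroup H D)
  (H_SL : forall g, H g /\ \det g = 1 <-> cyc (-1) g)
  (H_h : H h) (det_H : [set \det g | g in H] = cyc (\det h))
  (prim_det : e.-primitive_root (\det h)).

Let H_N1 : H (-1). Proof. by have [|//] := (H_SL (-1)).2; exists 1. Qed.

Let H_exprn g k : H g -> H (g ^+ k).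
Proof.
have [_ _ H1 HM _] := H_subgroup; move=> Hg.
by elim: k => [|k IHk]; rewrite ?expr0 // exprS; apply: HM.
Qed.

Lemma subgroup_expr_det : h ^+ e = 1 \/ h ^+ e = -1.
Proof.
apply: cyc_mx2N1P; apply/H_SL; split; first exact: H_exprn.
by rewrite det_exprn prim_expr_order.
Qed.

(** g and some h ^+ k have the same determinant, so that g / h ^+ k lies in the
    kernel {1, -1} of the determinant. *)
Lemma subgroup_signed_powers g : H g -> exists k, g = h ^+ k \/ g = - h ^+ k.
Proof.
move=> Hg; have [_ Hu _ HM HV] := H_subgroup.
have: cyc (\det h) (\det g) by rewrite -det_H; exists g.
move=> /(cyc_exprP (prim_order_gt0 prim_det) (prim_expr_order prim_det))[k _].
rewrite -det_exprn => det_g; exists k.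
have Hhk := H_exprn k H_h; have uhk : h ^+ k \is a GRing.unit := Hu _ Hhk.
suff /cyc_mx2N1P[] : cyc (-1) (g / h ^+ k).
- by move=> /(canRL (mulrVK uhk)) ->; left; rewrite mul1r.
- by move=> /(canRL (mulrVK uhk)) ->; right; rewrite mulN1r.
apply/H_SL; split; first by apply: HM => //; apply: HV.
by rewrite detM detV det_g divrr // -unitmxE.
Qed.

(** Here -1 = h ^+ e is itself a power of h, so the signs are absorbed. *)
Lemma isoC_subgroup : h ^+ e = -1 -> isoC (2 * e) H.
Proof.
move=> heN1; have prim_h := prim_expr_N1 prim_det heN1.
have e_gt0 := prim_order_gt0 prim_det.
have -> : H = cyc h; last by apply: isoC_cyc; first lia.
apply/seteqP; split=> g.
  move=> /subgroup_signed_powers[k [->|->]]; first exact: cyc_exprn.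
  by rewrite -mulN1r -heN1 -exprD; apply: cyc_exprn.
move=> /(cyc_exprP (prim_order_gt0 prim_h) (prim_expr_order prim_h))[k _ ->].
exact: H_exprn.
Qed.

Lemma isoCxC_subgroup : (1 < e)%N -> h ^+ e = 1 -> isoCxC 2 e H.
Proof.
move=> e_gt1 he1.
have -> : H = [set x * y | x in cyc (-1) & y in cyc h].
  apply/seteqP; split=> [g /subgroup_signed_powers[k [->|->]]|].
  - exists 1; [by exists 0 | exists (h ^+ k); rewrite ?mul1r //].
    exact: cyc_exprn.
  - exists (-1); [by exists 1 | exists (h ^+ k); rewrite ?mulN1r //].
    exact: cyc_exprn.
  have [_ _ _ HM _] := H_subgroup.
  move=> _ [x /H_SL[Hx _] [y + <-]].
  move=> /(cyc_exprP (ltnW e_gt1) he1)[k _ ->].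
  by apply: HM => //; apply: H_exprn.
apply: isoCxC_dprod (dprod_expr_1 prim_det he1) => //.
  exact: prim_mx2N1.
exact: prim_expr_1.
Qed.

End SubgroupsWithDet.

(** * Model groups with entries in a subring of the complex numbers *)

Section Subrings.
Variable F : realType.
Local Notation C := (F[i]).
Implicit Types (w z d c : C).

Definition is_subring (R : set C) : Prop :=
  [/\ R 1, forall x y, R x -> R y -> R (x - y)
    & forall x y, R x -> R y -> R (x * y)].

Variable R : set C.
Hypothesis R_ring : is_subring R.

Lemma subring1 : R 1. Proof. by case: R_ring. Qed.
Lemma subringB x y : R x -> R y -> R (x - y). Proof. by case: R_ring => _ + _; apply. Qed.
Lemma subringM x y : R x -> R y -> R (x * y). Proof. by case: R_ring => _ _; apply. Qed.
Lemma subring0 : R 0.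
Proof. by rewrite -(subrr 1); apply: subringB subring1 subring1. Qed.
Lemma subringN x : R x -> R (- x).
Proof. by rewrite -sub0r; apply: subringB subring0. Qed.
Lemma subringD x y : R x -> R y -> R (x + y).
Proof. by move=> Rx Ry; rewrite -[y]opprK; apply: subringB Rx (subringN Ry). Qed.
Lemma subring_int (m : int) : R m%:~R.
Proof.
have subring_nat n : R n%:R.
  elim: n => [|n IHn]; first exact: subring0.
  by rewrite -natr1; apply: subringD IHn subring1.
by case: m => n; [exact: subring_nat | rewrite NegzE rmorphN; apply/subringN/subring_nat].
Qed.
Lemma subringX x n : R x -> R (x ^+ n).
Proof.
move=> Rx; elim: n => [|n IHn]; first exact: subring1.
by rewrite exprS; apply: subringM.
Qed.

Lemma units_in_root d n : (0 < n)%N -> R d -> d ^+ n = 1 -> units_in R d.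
Proof.
case: n => // n _ Rd dn1; split=> //; exists (d ^+ n); last by rewrite -exprS.
exact: subringX.
Qed.

Lemma GL2M g h : GL2 R g -> GL2 R h -> GL2 R (g * h).
Proof.
move=> [Rg [Rdg [x Rx gx]]] [Rh [Rdh [y Ry hy]]]; split=> [i j|].
  by rewrite mulmx2E; apply: subringD; apply: subringM.
rewrite detM; split; first exact: subringM.
by exists (x * y); [exact: subringM | rewrite mulrACA gx hy mulr1].
Qed.

Lemma GL2_scalar a n : (0 < n)%N -> R a -> a ^+ n = 1 -> GL2 R a%:M.
Proof.
move=> n_gt0 Ra an1; split=> [i j|].
  by rewrite mxE; case: eqP => _; rewrite ?mulr1n ?mulr0n //; apply: subring0.
rewrite det_scalar; apply: (units_in_root n_gt0); first exact: subringX.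
by rewrite exprAC an1 expr1n.
Qed.

Lemma GL2X g n : GL2 R g -> GL2 R (g ^+ n).
Proof.
move=> GLg; elim: n => [|n IHn]; last by rewrite exprS; apply: GL2M.
by apply: (@GL2_scalar 1 1); rewrite ?expr1 //; apply: subring1.
Qed.

Lemma GL2N1 : GL2 R (-1).
Proof.
have -> : -1 = (-1)%:M :> 'M[C]_2 by rewrite -scalemx1 scaleN1r.
by apply: (@GL2_scalar _ 2) => //; [apply/subringN/subring1 | rewrite sqrrN expr1n].
Qed.

(** As g has finite order, its negative powers are also natural powers, so
    closure of GL(2, R) under products suffices. *)
Lemma cyc_GL2 n g : (0 < n)%N -> g ^+ n = 1 -> GL2 R g -> is_subgroup (cyc g) (GL2 R).
Proof.
move=> n_gt0 gn1 GLg; apply: is_subgroup_sub; first exact: cyc_subgroup n_gt0 gn1.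
by move=> _ /(cyc_exprP n_gt0 gn1)[k _ ->]; apply: GL2X.
Qed.

Lemma cyc_model e h : GL2 R h -> e.-primitive_root (\det h) -> h ^+ e = -1 ->
  is_subgroup (cyc h) (GL2 R) /\ isoC (2 * e) (cyc h).
Proof.
move=> GLh prim_det heN1; have prim_h := prim_expr_N1 prim_det heN1.
split; first exact: cyc_GL2 (prim_order_gt0 prim_h) (prim_expr_order prim_h) GLh.
by apply: isoC_cyc => //; have := prim_order_gt0 prim_h; lia.
Qed.

Definition mx2 a b c d : 'M[C]_2 :=
  \matrix_(i, j) if i == 0 then (if j == 0 then a else b)
                 else if j == 0 then c else d.

Lemma det_mx2 a b c d : \det (mx2 a b c d) = a * d - b * c.
Proof. by rewrite det2E !mxE. Qed.

Lemma mx2_eigenvalues a b c d l m : a + d = l + m -> a * d - b * c = l * m ->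
  eigenvalues2 (mx2 a b c d) l m.
Proof.
move=> trE detE; rewrite /eigenvalues2 char_poly2 det_mx2 detE !mxE /= trE.
by rewrite -mul_polyC polyCD polyCM; ring.
Qed.

Lemma GL2_mx2 n a b c d : (0 < n)%N -> R a -> R b -> R c -> R d ->
  (a * d - b * c) ^+ n = 1 -> GL2 R (mx2 a b c d).
Proof.
move=> n_gt0 Ra Rb Rc Rd det1; split; first by do 2!apply: ord2P; rewrite mxE.
rewrite det_mx2; apply: units_in_root n_gt0 _ det1.
by apply: subringB; apply: subringM.
Qed.

Lemma mx2_diagX a k : mx2 a 0 0 1 ^+ k = mx2 (a ^+ k) 0 0 1.
Proof.
elim: k => [|k IHk]; first by apply: mx2P; rewrite !mxE.
by rewrite !exprS IHk; apply: mx2P; rewrite mulmx2E !mxE /=; ring.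
Qed.

Lemma mx2_companion_sqr a : mx2 0 (- a) 1 0 ^+ 2 = (- a)%:M.
Proof. by rewrite expr2; apply: mx2P; rewrite mulmx2E !mxE /=; ring. Qed.

(** h = diag(a, 1) has the order e of its determinant a, so that -1 is not one of
    its powers. *)
Lemma dprod_model e a : (1 < e)%N -> R a -> e.-primitive_root a ->
  let h := mx2 a 0 0 1 in
  let G := [set x * y | x in cyc (-1) & y in cyc h] in
  [/\ GL2 R h, eigenvalues2 h a 1, is_dprod (cyc (-1)) (cyc h) G,
      isoCxC 2 e G & is_subgroup G (GL2 R)].
Proof.
move=> e_gt1 Ra prim_a h G; have e_gt0 := ltnW e_gt1.
have prim_det : e.-primitive_root (\det h) by rewrite det_mx2 mulr1 mulr0 subr0.
have he1 : h ^+ e = 1.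
  by rewrite mx2_diagX (prim_expr_order prim_a); apply: mx2P; rewrite !mxE.
have GLh : GL2 R h.
  apply: (GL2_mx2 e_gt0); rewrite ?mulr1 ?mulr0 ?subr0 ?(prim_expr_order prim_a) //;
    by [exact: subring0 | exact: subring1].
have dG : is_dprod (cyc (-1)) (cyc h) G by exact: dprod_expr_1 prim_det he1.
split=> //.
- by apply: mx2_eigenvalues; rewrite ?mulr0 ?subr0.
- apply: isoCxC_dprod dG => //; [exact: prim_mx2N1 | exact: prim_expr_1].
apply: is_subgroup_sub.
  apply: is_dprod_subgroup dG; last exact: cyc_subgroup he1.
  exact: cyc_subgroup (prim_expr_order (prim_mx2N1 _)).
move=> _ [x /cyc_mx2N1P x1 [y /(cyc_exprP e_gt0 he1)[k _ ->] <-]].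
apply: GL2M; last exact: GL2X.
by case: x1 => ->; [rewrite -(expr0 h); apply: GL2X | exact: GL2N1].
Qed.

(** Cayley-Hamilton gives (tr h) h = h ^+ 2 + det h = -2, so h is scalar, and
    its diagonal entry is a square root of -1. *)
Lemma scalar_of_sqrN1 (h : 'M[C]_2) : \det h = -1 -> h ^+ 2 = -1 -> h 0 0 ^+ 2 = -1.
Proof.
move=> dh h2; have := sqr_mx2 h; rewrite dh h2 => /matrixP trE.
have /= h2E := mulmx2E h h 0 0; rewrite -expr2 h2 in h2E.
have := trE 0 0; have := trE 0 1; rewrite -scaleN1r in h2E *.
rewrite !mxE /= !(mulr1n, mulr0n, mulr0, mulr1, subr0, opprK) in h2E *.
move=> /esym/eqP; rewrite mulf_eq0 => /orP[/eqP-> | /eqP h01 _].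
  by rewrite mul0r add0r => /eqP; rewrite -subr_eq0 -opprD oppr_eq0 (pnatr_eq0 _ 2).
by rewrite expr2 h2E h01 mul0r addr0.
Qed.

End Subrings.

(** * Endomorphism rings of elliptic curves *)

Section EndomorphismRings.
Variable F : realType.
Local Notation C := (F[i]).
Implicit Types (R : set C) (w z d c s : C).

(** The arithmetic of R that the classification uses: for non-real z, these are
    the trace and the norm of the quadratic integer z. *)
Definition int_trace_norm R : Prop := forall z, R z ->
  exists t n : int, z + z^* = t%:~R /\ z * z^* = n%:~R.

Lemma conjC_i : ('i%C : C)^* = - 'i%C.
Proof. by apply/eqP; rewrite eq_complex /= oppr0 !eqxx. Qed.

Lemma sqr_i_C : ('i%C : C) ^+ 2 = -1. Proof. exact: sqr_i. Qed.

Lemma elliptic_End_subring R : is_elliptic_End R -> is_subring R.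
Proof.
move=> [w1 [w2 [_ ->]]]; split=> [l|x y Rx Ry l Ll|x y Rx Ry l Ll] /=.
- by rewrite mul1r.
- have [m [n Ex]] := Rx l Ll; have [m' [n' Ey]] := Ry l Ll.
  by exists (m - m'), (n - n'); rewrite mulrBl Ex Ey !rmorphB /=; ring.
- by rewrite -mulrA; apply/Rx/Ry.
Qed.

Lemma conj_fixed_real z : z^* = z -> exists a : F, z = a%:C%C.
Proof.
case: z => x y /eqP; rewrite eq_complex /= => /andP[_ /eqP Ny].
exists x; apply/eqP; rewrite eq_complex /= eqxx /=; apply/eqP; lra.
Qed.

(** The matrix of the multiplication by z on the lattice has characteristic
    polynomial X^2 - (a + d) X + (ad - bc), with z as a root.  If z is not real,
    its other root is z^*; if z is real, then z w1 = a w1 + b w2 and the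
    independence of w1 and w2 over the reals force z = a. *)
Lemma elliptic_End_trace_norm R : is_elliptic_End R -> int_trace_norm R.
Proof.
move=> [w1 [w2 [indep ->]]] z Rz.
have Cint (m : int) : m%:~R = (m%:~R : F)%:C%C :> C by rewrite rmorph_int.
have [a [b zw1]] : lattice w1 w2 (z * w1).
  by apply: Rz; exists 1, 0; rewrite mul0r addr0 mul1r.
have [c [d zw2]] : lattice w1 w2 (z * w2).
  by apply: Rz; exists 0, 1; rewrite mul0r add0r mul1r.
have w1_neq0 : w1 != 0.
  apply/eqP => w10; have [] := indep 1 0; first by rewrite w10 mulr0 mul0r addr0.
  by move/eqP; rewrite oner_eq0.
have charz : z ^+ 2 - (a + d)%:~R * z + (a * d - b * c)%:~R = 0.
  apply: (mulIf w1_neq0); rewrite mul0r !(rmorphB, rmorphD, rmorphM) /=.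
  (* z is eliminated between the two lattice equations, as in the proof that
     an eigenvalue is a root of the characteristic polynomial. *)
  have -> : (z ^+ 2 - (a%:~R + d%:~R) * z + (a%:~R * d%:~R - b%:~R * c%:~R)) * w1
     = (z - d%:~R) * (z * w1 - a%:~R * w1 - b%:~R * w2)
       + b%:~R * (z * w2 - c%:~R * w1 - d%:~R * w2) by ring.
  by rewrite zw1 zw2; ring.
have [zreal|z_nreal] := eqVneq z^* z.
  have [x zE] := conj_fixed_real zreal.
  have [] := indep (x - a%:~R) (- b%:~R).
    rewrite rmorphB rmorphN /= -!Cint -zE mulrBl zw1; ring.
  move=> /eqP; rewrite subr_eq0 => /eqP xa _.
  have za : z = a%:~R by rewrite zE xa Cint.
  exists (a + a), (a * a); rewrite zreal za rmorphD rmorphM; split=> //.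
have trz : z + z^* = (a + d)%:~R.
  have := congr1 Num.conj charz.
  rewrite rmorph0 rmorphD rmorphB rmorphXn rmorphM !rmorph_int => charz_conj.
  have : (z - z^*) * (z + z^* - (a + d)%:~R) = 0.
    rewrite -[RHS](subrr 0) -[X in _ = X - _]charz.
    by rewrite -[X in _ = _ - X]charz_conj; ring.
  move=> /eqP; rewrite mulf_eq0 subr_eq0 eq_sym (negbTE z_nreal) subr_eq0.
  by move=> /eqP.
exists (a + d), (a * d - b * c); split=> //.
have -> : z^* = (a + d)%:~R - z by rewrite -trz addrC addKr.
by apply/eqP; rewrite -subr_eq0 -oppr_eq0 -charz; apply/eqP; ring.
Qed.

(** Since |d| = 1, d is a root of X^2 - t X + 1 with t = d + d^* an integer of
    absolute value at most 2; t = 2 gives d = 1 and t = -2 gives d = -1. *)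
Lemma root_of_unity_quadratic R d r : int_trace_norm R -> R d -> (0 < r)%N ->
  d ^+ r = 1 -> d != 1 ->
  [\/ d = -1, d ^+ 2 + d + 1 = 0, d ^+ 2 = -1 | d ^+ 2 - d + 1 = 0].
Proof.
move=> R_int Rd r_gt0 dr1 d_neq1; have [t [n [trd _]]] := R_int d Rd.
have d_norm : `|d| = 1.
  by apply/eqP; rewrite -(pexpr_eq1 r_gt0) // -normrX dr1 normr1.
have normd : d * d^* = 1 by rewrite -normCK d_norm expr1n.
have t_le2 : `|t| <= 2.
  rewrite -(ler_int C) intr_norm -trd; apply: le_trans (ler_normD _ _) _.
  by rewrite norm_conjC d_norm.
have quad : d ^+ 2 - t%:~R * d + 1 = 0 by rewrite -trd -normd; ring.
have : [\/ t = -2, t = -1, t = 0 | t = 1] \/ t = 2.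
  have : [|| t == -2, t == -1, t == 0, t == 1 | t == 2] by lia.
  case/or4P => [/eqP|/eqP|/eqP|/orP[/eqP|/eqP]];
    by [left; constructor | right].
case=> [[]|] tE; rewrite {}tE in quad.
- constructor 1; have : (d + 1) ^+ 2 = 0 by rewrite -quad; ring.
  by move/eqP; rewrite expf_eq0 /= addr_eq0 => /eqP.
- by constructor 2; rewrite -quad; ring.
- by constructor 3; apply/eqP; rewrite -subr_eq0 -quad; apply/eqP; ring.
- by constructor 4; rewrite -quad; ring.
have : (d - 1) ^+ 2 = 0 by rewrite -quad; ring.
by move/eqP; rewrite expf_eq0 /= subr_eq0 (negbTE d_neq1).
Qed.

Lemma sqrN1_i c : c ^+ 2 = -1 -> c = 'i%C \/ c = - 'i%C.
Proof.
by rewrite -sqr_i_C => /eqP; rewrite eqf_sqr => /orP[/eqP|/eqP]; [left|right].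
Qed.

(** Otherwise s is real and its square is nonnegative. *)
Lemma conj_sqrN3 s : s ^+ 2 = - 3%:R -> s^* = - s.
Proof.
move=> s2; have : s^* ^+ 2 = s ^+ 2 by rewrite -rmorphXn s2 rmorphN rmorph_nat.
move/eqP; rewrite eqf_sqr => /orP[/eqP sR|/eqP//].
by have := mul_conjC_ge0 s; rewrite sR -expr2 s2 oppr_ge0 lern0.
Qed.

(** With t and u the traces of z and 'i z, one has 2 z = t - u 'i, and the norm n
    gives t^2 + u^2 = 4 n, so that t and u are even. *)
Lemma eq_gaussian_integers R c : is_subring R -> int_trace_norm R ->
  R c -> c ^+ 2 = -1 -> R = @gaussian_integers F.
Proof.
move=> R_ring R_int Rc /sqrN1_i c_i.
have Ri : R 'i%C.
  case: c_i => cE; rewrite cE in Rc => //.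
  by rewrite -[X in R X]opprK; apply: subringN.
apply/seteqP; split=> [z Rz | _ [a [b ->]]]; last first.
  apply: (subringD R_ring); first exact: subring_int.
  by apply: subringM => //; apply: subring_int.
have [t [n [tr_z norm_z]]] := R_int z Rz.
have [u [_ [tr_iz _]]] := R_int _ (subringM R_ring Ri Rz).
have zE : z *+ 2 = t%:~R - u%:~R * 'i%C.
  rewrite -tr_z -tr_iz rmorphM /= conjC_i.
  have -> : ('i%C * z + - 'i%C * z^*) * 'i%C = 'i%C ^+ 2 * (z - z^*) by ring.
  by rewrite sqr_i_C; ring.
have : (t ^+ 2 + u ^+ 2)%:~R = (4 * n)%:~R :> C.
  have zE' : z^* *+ 2 = t%:~R + u%:~R * 'i%C.
    have := congr1 Num.conj zE.
    by rewrite rmorphMn rmorphB rmorphM !rmorph_int /= conjC_i mulrN opprK.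
  rewrite rmorphD !rmorphXn rmorphM /= -norm_z.
  have -> : 4%:~R * (z * z^*) = (z *+ 2) * (z^* *+ 2) by ring.
  rewrite zE zE'.
  have -> : (t%:~R - u%:~R * 'i%C) * (t%:~R + u%:~R * 'i%C)
     = t%:~R ^+ 2 - u%:~R ^+ 2 * 'i%C ^+ 2 :> C by ring.
  by rewrite sqr_i_C mulrN1 opprK.
move=> /intr_inj tu4.
have [a tE] : exists a, t = 2 * a.
  exists (t %/ 2)%Z; have := divz_eq t 2; have := divz_eq u 2.
  have : (t %% 2)%Z = 0 \/ (t %% 2)%Z = 1 by lia.
  have : (u %% 2)%Z = 0 \/ (u %% 2)%Z = 1 by lia.
  by case=> -> [] -> uE tE; rewrite uE tE in tu4; lia.
have [b uE] : exists b, u = 2 * b.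
  exists (u %/ 2)%Z; have := divz_eq u 2.
  have : (u %% 2)%Z = 0 \/ (u %% 2)%Z = 1 by lia.
  by case=> -> uE; rewrite tE uE in tu4; lia.
exists a, (- b); have two_neq0 : 2%:R != 0 :> C by rewrite pnatr_eq0.
apply: (mulIf two_neq0); rewrite mulr_natr zE tE uE rmorphN !rmorphM /=; ring.
Qed.

(** By Gauss's lemma, X - q is a rational multiple of an integer factor p1 of
    the monic polynomial p, and the leading coefficient of p1 is 1 or -1. *)
Lemma integral_rat_int (q : rat) :
  integralOver (intr : int -> C) (ratr q) -> exists m : int, q = m%:~R.
Proof.
move=> [p p_monic].
have -> : map_poly (intr : int -> C) p = map_poly ratr (map_poly (intr : int -> rat) p).
  by rewrite -map_poly_comp; apply: eq_map_poly => m /=; rewrite ratr_int.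
rewrite fmorph_root -dvdp_XsubCl => /dvdpP_rat_int[p1 [a a_neq0 qE]] [p2 pE].
have lead1 : lead_coef p1 * lead_coef p2 = 1 by rewrite -lead_coefM -pE; apply/eqP.
have leadp1 : a * (lead_coef p1)%:~R = 1.
  have := congr1 lead_coef qE.
  by rewrite lead_coefXsubC lead_coefZ lead_coef_map_inj //; exact: intr_inj.
have aE : a = (lead_coef p2)%:~R.
  have : (lead_coef p1)%:~R * (lead_coef p2)%:~R = 1 :> rat by rewrite -rmorphM lead1.
  move=> l1; have l1_neq0 : (lead_coef p1)%:~R != 0 :> rat.
    by apply: contraTneq (oner_neq0 rat) => l0; rewrite -l1 l0 mul0r eqxx.
  by apply: (mulIf l1_neq0); rewrite leadp1 mulrC l1.
have := congr1 (fun r : {poly rat} => r`_0) qE.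
rewrite coefB coefX coefC coefZ coef_map /= sub0r aE => E.
by exists (- (lead_coef p2 * p1`_0)); rewrite rmorphN rmorphM /= -E opprK.
Qed.

Lemma integral_trace_norm z (t n : int) :
  z + z^* = t%:~R -> z * z^* = n%:~R -> integralOver (intr : int -> C) z.
Proof.
move=> tr_z norm_z; exists ('X^2 - t *: 'X + n%:P).
  rewrite monicE -addrA lead_coefDl ?lead_coefXn // size_polyXn ltnS.
  rewrite (leq_trans (size_polyD _ _)) // geq_max size_polyN.
  rewrite (leq_trans (size_scale_leq _ _)) ?size_polyX //=.
  by rewrite size_polyC; case: (n != 0).
rewrite /root rmorphD rmorphB /= map_polyXn map_polyZ map_polyX map_polyC /=.
by rewrite !hornerE -tr_z -norm_z; apply/eqP; ring.
Qed.

Lemma integral_conj z :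
  integralOver (intr : int -> C) z -> integralOver (intr : int -> C) z^*.
Proof.
move=> /(integral_rmorph (Num.conj : {rmorphism C -> C})).
suff -> : Num.conj \o (intr : int -> C) = intr by [].
by apply/funext => m /=; rewrite rmorph_int.
Qed.

(** An element z of R is a rational combination of 1 and s = sqrt (-3) because
    the traces of z and s z are integers.  Conversely, let z = a + b s be
    integral.  Then m = 2 a, v = 6 b and n = a^2 + 3 b^2 are integral and
    rational, hence integers, with 12 n = 3 m^2 + v^2.  So v = 3 w with m - w
    even, and z = (m - w) / 2 + w q, where q = (1 + s) / 2 is in R. *)
Lemma eq_quad_integers_3 R d : is_subring R -> int_trace_norm R ->
  R d -> d ^+ 2 + d + 1 = 0 -> R = quad_integers 3.
Proof.
move=> R_ring R_int Rd d3.
pose s : C := sqrtC (- 3%:R); have s2 : s ^+ 2 = - 3%:R by exact: sqrtCK.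
have s_conj := conj_sqrN3 s2.
have ratrC (x : rat) : (ratr x : C)^* = ratr x by rewrite fmorph_rat.
have [q Rq sE] : exists2 q, R q & s = 2 * q - 1.
  have : s ^+ 2 = (2 * d + 1) ^+ 2.
    by apply/eqP; rewrite s2 -subr_eq0 -(mulr0 (- 4)) -d3; apply/eqP; ring.
  move/eqP; rewrite eqf_sqr => /orP[] /eqP ->.
    by exists (d + 1); [exact: subringD (subring1 R_ring) | ring].
  by exists (- d); [exact: subringN | ring].
have Rs : R s.
  rewrite sE; apply: subringB (subring1 _) => //.
  by apply: subringM => //; apply: (subring_int R_ring 2).
have s_int : integralOver (intr : int -> C) s.
  by have [t [n [? ?]]] := R_int s Rs; apply: (@integral_trace_norm _ t n).
apply/seteqP; split=> z.
  move=> Rz; have [t [n [tr_z norm_z]]] := R_int z Rz.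
  split; last exact: integral_trace_norm tr_z norm_z.
  have [u [_ [tr_sz _]]] := R_int _ (subringM R_ring Rs Rz).
  exists (t%:~R / 2), (- u%:~R / 6); rewrite -/s.
  rewrite !fmorph_div /= rmorphN /= !ratr_int !ratr_nat -tr_z -tr_sz rmorphM /= s_conj.
  have -> : - (s * z + - s * z^*) / 6 * s = - s ^+ 2 * (z - z^*) / 6 by ring.
  by rewrite s2; field.
move=> [[a [b]]]; rewrite -/s => zE z_int.
have z_conj : z^* = ratr a - ratr b * s.
  by rewrite zE rmorphD /= [(ratr b * s)^*]rmorphM /= !ratrC s_conj mulrN.
have z_conj_int := integral_conj z_int.
have [m mE] : exists m : int, a * 2 = m%:~R.
  apply: integral_rat_int; have -> : ratr (a * 2) = z + z^* :> C.
    by rewrite z_conj zE rmorphM /= ratr_nat; ring.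
  exact: integral_add.
have [v vE] : exists v : int, b * 6 = v%:~R.
  apply: integral_rat_int; have -> : ratr (b * 6) = (z^* - z) * s :> C.
    have -> : (z^* - z) * s = - 2 * ratr b * s ^+ 2 by rewrite z_conj zE; ring.
    by rewrite s2 rmorphM /= ratr_nat; ring.
  by apply: integral_mul => //; apply: integral_sub.
have [n nE] : exists n : int, a ^+ 2 + 3 * b ^+ 2 = n%:~R.
  apply: integral_rat_int; have -> : ratr (a ^+ 2 + 3 * b ^+ 2) = z * z^* :> C.
    have -> : z * z^* = ratr a ^+ 2 - ratr b ^+ 2 * s ^+ 2 by rewrite z_conj zE; ring.
    by rewrite s2 rmorphD rmorphM /= !rmorphXn /= ratr_nat; ring.
  exact: integral_mul.
have mvn : 12 * n = 3 * m ^+ 2 + v ^+ 2.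
  apply: (intr_inj (R := rat)); rewrite rmorphD !rmorphM /= -mE -vE -nE; ring.
have [w vw] : exists w : int, v = 3 * w.
  exists (v %/ 3)%Z; have := divz_eq v 3.
  have : [\/ (v %% 3)%Z = 0, (v %% 3)%Z = 1 | (v %% 3)%Z = 2].
    have : [|| (v %% 3)%Z == 0, (v %% 3)%Z == 1 | (v %% 3)%Z == 2] by lia.
    by case/or3P => /eqP; constructor.
  by case=> -> vq; rewrite vq in mvn; lia.
have [k mw] : exists k : int, m = 2 * k + w.
  exists ((m - w) %/ 2)%Z; have := divz_eq (m - w) 2.
  have : ((m - w) %% 2)%Z = 0 \/ ((m - w) %% 2)%Z = 1 by lia.
  case=> -> mq; first lia.
  have mE' : m = ((m - w) %/ 2)%Z * 2 + 1 + w by lia.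
  by move: mE' mvn; rewrite vw; move: (((m - w) %/ 2)%Z) => p ->; lia.
have aE : a = k%:~R + w%:~R / 2.
  by have : a = (a * 2) / 2; [field | rewrite mE mw rmorphD rmorphM /= => ->; field].
have bE : b = w%:~R / 2.
  by have : b = (b * 6) / 6; [field | rewrite vE vw rmorphM /= => ->; field].
have -> : z = k%:~R + w%:~R * q.
  by rewrite zE aE bE rmorphD /= !fmorph_div /= !ratr_int ratr_nat sE; field.
apply: (subringD R_ring); first exact: subring_int.
by apply: subringM => //; apply: subring_int.
Qed.

(** With s a square root of -3, conjugation negates both c and s, so the trace
    t of c s is 2 c s and t^2 = 4 * (-1) * (-3) = 12; 12 is not a square. *)
Lemma not_sqrN1_and_quad_3 R c d : is_subring R -> int_trace_norm R ->
  R c -> c ^+ 2 = -1 -> R d -> d ^+ 2 - d + 1 = 0 -> False.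
Proof.
move=> R_ring R_int Rc c2 Rd d6; pose s := d + d - 1.
have s2 : s ^+ 2 = - 3%:R.
  by apply/eqP; rewrite -subr_eq0 -(mulr0 4) -d6; apply/eqP; rewrite /s; ring.
have Rs : R s by apply: subringB (subring1 R_ring) => //; apply: subringD.
have c_conj : c^* = - c.
  by have [->|->] := sqrN1_i c2; rewrite ?rmorphN /= conjC_i.
have [t [_ [tE _]]] := R_int _ (subringM R_ring Rc Rs).
have : (t ^+ 2)%:~R = 12%:~R :> C.
  rewrite rmorphXn /= -tE rmorphM /= c_conj (conj_sqrN3 s2).
  have -> : (c * s + - c * - s) ^+ 2 = 4 * (c ^+ 2 * s ^+ 2) by ring.
  by rewrite c2 s2; ring.
move/intr_inj; have := divz_eq t 3.
have : [\/ (t %% 3)%Z = 0, (t %% 3)%Z = 1 | (t %% 3)%Z = 2].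
  have : [|| (t %% 3)%Z == 0, (t %% 3)%Z == 1 | (t %% 3)%Z == 2] by lia.
  by case/or3P => /eqP; constructor.
by case=> -> -> ; lia.
Qed.

End EndomorphismRings.

(** The two roots of X^2 - X + 1 are d and 1 - d. *)
Lemma subring_quad6 (F : realType) (R : set F[i]) d z : is_subring R ->
  R d -> d ^+ 2 - d + 1 = 0 -> z ^+ 2 - z + 1 = 0 -> R z.
Proof.
move=> R_ring Rd d6 z6; have : (d - z) * (d + z - 1) = 0.
  have -> : (d - z) * (d + z - 1) = (d ^+ 2 - d + 1) - (z ^+ 2 - z + 1) by ring.
  by rewrite d6 z6 subrr.
move=> /eqP; rewrite mulf_eq0 => /orP[|/eqP dz].
  by rewrite subr_eq0 => /eqP<-.
have -> : z = 1 - d by rewrite -[LHS]subr0 -dz; ring.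
exact: subringB (subring1 _) Rd.
Qed.

(** * Roots of unity of order 2, 3, 4, 6 and 8 *)

Section SmallRootsOfUnity.
Variable C : numFieldType.
Implicit Types d : C.

Lemma prim_root_proper d n : (0 < n)%N -> d ^+ n = 1 ->
  (forall m, (m < n)%N -> (m %| n)%N -> d ^+ m != 1) -> n.-primitive_root d.
Proof.
move=> n_gt0 dn1 proper; have [m prim_m m_dvd] := prim_order_exists n_gt0 dn1.
have := dvdn_leq n_gt0 m_dvd; rewrite leq_eqVlt => /orP[/eqP<- // | /proper/(_ m_dvd)].
by rewrite prim_expr_order ?eqxx.
Qed.

Lemma N1_neq1 : -1 != 1 :> C.
Proof. by rewrite -subr_eq0 -opprD oppr_eq0 (pnatr_eq0 _ 2). Qed.

Lemma prim_root2 : 2.-primitive_root (-1 : C).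
Proof.
apply: prim_root_proper => // [|[|[|//]] // _ _]; first by rewrite sqrrN expr1n.
by rewrite expr1 N1_neq1.
Qed.

Lemma prim_root3 d : d ^+ 2 + d + 1 = 0 -> 3.-primitive_root d.
Proof.
move=> d3; apply: prim_root_proper => // [|[|[|[|//]]] // _ _].
  by apply/eqP; rewrite -subr_eq0 -(mulr0 (d - 1)) -d3; apply/eqP; ring.
rewrite expr1; apply: contra_eq_neq d3 => ->.
by rewrite expr1n (_ : 1 + 1 + 1 = 3%:R :> C) ?pnatr_eq0 //; ring.
Qed.

Lemma prim_root4 d : d ^+ 2 = -1 -> 4.-primitive_root d.
Proof.
move=> d2; apply: prim_root_proper => // [|[|[|[|[|//]]]] // _ _].
- by rewrite (exprM d 2 2) d2 sqrrN expr1n.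
- by apply: contra_eq_neq d2; rewrite expr1 => ->; rewrite expr1n eq_sym N1_neq1.
- by rewrite d2 N1_neq1.
Qed.

Lemma quad6_cube d : d ^+ 2 - d + 1 = 0 -> d ^+ 3 = -1.
Proof.
by move=> d6; apply/eqP; rewrite -subr_eq0 opprK -(mulr0 (d + 1)) -d6; apply/eqP; ring.
Qed.

Lemma prim_root6 d : d ^+ 2 - d + 1 = 0 -> 6.-primitive_root d.
Proof.
move=> d6; have d3 := quad6_cube d6.
apply: prim_root_proper => // [|[|[|[|[|[|[|//]]]]]] // _ _].
- by rewrite (exprM d 3 2) d3 sqrrN expr1n.
- apply: contra_eq_neq d6; rewrite expr1 => ->.
  by rewrite expr1n subrr add0r oner_neq0.
- apply: contra_eq_neq d6 => d2; rewrite d2; apply: contraTneq isT => d_eq.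
  have d_2 : d = 2%:R by rewrite -[LHS]addr0 -d_eq; ring.
  move: d2; rewrite d_2 => /eqP; rewrite -subr_eq0.
  by rewrite (_ : 2%:R ^+ 2 - 1 = 3%:R :> C) ?pnatr_eq0 //; ring.
- by rewrite d3 N1_neq1.
Qed.

End SmallRootsOfUnity.

Section Cis.
Variable F : realType.
Local Notation C := (F[i]).
Implicit Types t u : F.

Lemma cisD t u : cis (t + u) = cis t * cis u.
Proof.
rewrite /cis cosD sinD; apply/eqP; rewrite eq_complex /= eqxx /=.
by apply/eqP; ring.
Qed.

Lemma cis_pi : cis pi = -1 :> C.
Proof. by rewrite /cis cospi sinpi; apply/eqP; rewrite eq_complex /= oppr0 !eqxx. Qed.

Lemma cis_Npihalf : cis (- (pi / 2)) = - 'i%C :> C.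
Proof.
rewrite /cis cosN sinN cos_pihalf sin_pihalf.
by apply/eqP; rewrite eq_complex /= oppr0 !eqxx.
Qed.

(** z = exp (pi i / 3) satisfies z^3 + 1 = (z + 1) (z^2 - z + 1) = 0, and z is
    not -1 because its imaginary part is positive. *)
Lemma cis_pi3 : let z : C := cis (pi / 3%:R) in z ^+ 2 - z + 1 = 0.
Proof.
move=> z; have z3 : z ^+ 3 = -1.
  by rewrite !exprS expr0 mulr1 -!cisD -cis_pi; congr cis; field.
have zN1 : z + 1 != 0.
  apply: contraTneq (pi_gt0 F) => /eqP; rewrite eq_complex /= addr0 => /andP[_ /eqP s0].
  by have := @sin_gt0_pi F (pi / 3%:R); rewrite s0; have := pi_gt0 F; lra.
by apply: (mulfI zN1); rewrite mulr0 -[RHS](subrr (-1)) -{1}z3; ring.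
Qed.

Lemma cis_3pi4 : cis (3%:R * pi / 4%:R) = - cis (- (pi / 4%:R)) :> C.
Proof. by rewrite -mulN1r -cis_pi -cisD; congr cis; field. Qed.

Lemma sqr_cis_Npi4 : (cis (- (pi / 4%:R)) : C) ^+ 2 = - 'i%C.
Proof. by rewrite expr2 -cisD -cis_Npihalf; congr cis; field. Qed.

End Cis.

(** The companion matrix of X^2 + 'i has determinant 'i, of order 4, and its
    square is the scalar - 'i; its eigenvalues are the square roots of - 'i. *)
Lemma cyc8_model (F : realType) (R : set F[i]) : is_subring R -> R 'i%C ->
  exists h, [/\ GL2 R h,
    eigenvalues2 h (cis (3%:R * pi / 4%:R)) (cis (- (pi / 4%:R))),
    is_subgroup (cyc h) (GL2 R) & isoC (2 * 4) (cyc h)].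
Proof.
move=> R_ring Ri; have prim_i := prim_root4 (@sqr_i_C F).
have [h hE] : exists h : 'M[F[i]]_2, h = mx2 0 (- 'i%C) 1 0 by eexists.
have det_h : \det h = 'i%C by rewrite hE det_mx2 mulr0 sub0r mulr1 opprK.
have GLh : GL2 R h.
  rewrite hE; apply: (GL2_mx2 R_ring (isT : (0 < 4)%N)).
  - exact: subring0.
  - exact: subringN.
  - exact: subring1.
  - exact: subring0.
  - by rewrite -det_mx2 -hE det_h (prim_expr_order prim_i).
have h4 : h ^+ 4 = -1.
  rewrite (exprM h 2 2) hE mx2_companion_sqr -rmorphXn sqrrN sqr_i_C.
  exact: rmorphN1.
have [subG isoG] : is_subgroup (cyc h) (GL2 R) /\ isoC (2 * 4) (cyc h).
  by apply: (cyc_model R_ring GLh _ h4); rewrite det_h.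
exists h; apply: And4 GLh _ subG isoG.
rewrite hE; apply: mx2_eigenvalues; rewrite cis_3pi4; first by rewrite addr0 addNr.
by rewrite mul0r mulr1 sub0r opprK mulNr -expr2 sqr_cis_Npi4 opprK.
Qed.

(** * The classification *)

Theorem proposition31 (F : realType) (R : set F[i]) (H : set 'M[F[i]]_2)
    (ho : 'M[F[i]]_2) (r s : nat) (l1 l2 : F[i])
    (R_End : is_elliptic_End R)
    (H_subgroup : is_subgroup H (GL2 R))
    (H_finite : finite_set H)
    (H_SL : H `&` SL2 R = cyc (- 1))
    (H_SL_C2 : isoC 2 (H `&` SL2 R))
    (H_ho : H ho)
    (ho_order : r.-primitive_root ho)
    (det_H : [set \det h | h in H] = cyc (\det ho))
    (det_H_Cs : isoC s [set \det h | h in H])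
    (s_gt1 : (1 < s)%N)
    (ho_eigenvalues : eigenvalues2 ho l1 l2) :
  exists k : nat, (1 <= k <= 7)%N /\
    exists G : set 'M[F[i]]_2,
      [/\ is_subgroup G (GL2 R), HC2 R k G & isomorphic H G].
Proof.
have R_ring := elliptic_End_subring R_End.
have R_int := elliptic_End_trace_norm R_End.
have [H_GL _ _ _ _] := H_subgroup.
have H_SL' g : H g /\ \det g = 1 <-> cyc (-1) g.
  rewrite -H_SL; split=> [[Hg dg]|[Hg [_ dg]]]; split=> //.
  by split=> //; apply: H_GL.
have [_ [Rd _]] := H_GL ho H_ho.
have r_gt0 := prim_order_gt0 ho_order.
have dr1 : \det ho ^+ r = 1 by rewrite -det_exprn (prim_expr_order ho_order) det1.
have d_neq1 : \det ho != 1.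
  by apply: contraTneq s_gt1 => d1; rewrite -leqNgt (@isoC_cyc1 F[i] s) // -d1 -det_H.
have RN1 : R (-1) := subringN R_ring (subring1 R_ring).
have [dE|d3|d4|d6] := root_of_unity_quadratic R_int Rd r_gt0 dr1 d_neq1.
- have prim_d : 2.-primitive_root (\det ho) by rewrite dE prim_root2.
  have [h1|hN1] := subgroup_expr_det H_subgroup H_SL' H_ho prim_d.
    exists 2; split=> //.
    have [GLh eig dG isoG subG] :=
      dprod_model R_ring (isT : (1 < 2)%N) RN1 (prim_root2 F[i]).
    eexists; split; first exact: subG.
      exists (mx2 (-1) 0 0 1); apply: And4 GLh _ dG isoG.
      by rewrite /eigenvalues2 mulrC.
    apply: isomorphic_isoCxC isoG.
    exact: isoCxC_subgroup H_subgroup H_SL' H_ho det_H prim_d isT h1.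
  exists 1; split=> //.
  have [R_ho _] := H_GL ho H_ho.
  have R_gauss := eq_gaussian_integers R_ring R_int (R_ho 0 0) (scalar_of_sqrN1 dE hN1).
  have Ri : R 'i%C by rewrite R_gauss; exists 0, 1; rewrite add0r mul1r.
  have [subG isoG] : is_subgroup (cyc ('i%C)%:M) (GL2 R) /\
      isoC (2 * 2) (cyc (('i%C)%:M : 'M[F[i]]_2)).
    apply: cyc_model => //.
    - apply: (@GL2_scalar _ _ _ _ 4) => //.
      exact: (prim_expr_order (prim_root4 (@sqr_i_C F))).
    - by rewrite det_scalar sqr_i_C prim_root2.
    - by rewrite -rmorphXn /= sqr_i_C rmorphN1.
  exists (cyc ('i%C)%:M); split; [exact: subG | exact: And3 R_gauss erefl isoG | ].
  apply: isomorphic_isoC isoG.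
  exact: isoC_subgroup H_subgroup H_SL' H_ho det_H prim_d hN1.
- have prim_d := prim_root3 d3; exists 3; split=> //.
  have R_eis := eq_quad_integers_3 R_ring R_int Rd d3.
  pose z : F[i] := cis (pi / 3%:R); have z6 : z ^+ 2 - z + 1 = 0 := cis_pi3 F.
  have z2 : (z ^+ 2) ^+ 2 + z ^+ 2 + 1 = 0.
    by rewrite -(mulr0 (z ^+ 2 + z + 1)) -z6; ring.
  have Rz : R z.
    apply: (subring_quad6 R_ring (subringN R_ring Rd)) z6.
    by rewrite sqrrN opprK.
  have GLz : GL2 R z%:M.
    apply: (@GL2_scalar _ _ R_ring z 6) => //.
    exact: (prim_expr_order (prim_root6 z6)).
  have [subG isoG] : is_subgroup (cyc z%:M) (GL2 R) /\
      isoC (2 * 3) (cyc (z%:M : 'M[F[i]]_2)).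
    apply: cyc_model => //.
      by rewrite det_scalar prim_root3.
    by rewrite -rmorphXn /= (quad6_cube z6) rmorphN1.
  exists (cyc z%:M); split; first exact: subG.
    by exists z%:M; apply: And5 R_eis GLz _ erefl isoG; left.
  apply: isomorphic_isoC isoG.
  (* If ho ^+ 3 = 1, then (- ho) ^+ 3 = -1 while det (- ho) = det ho. *)
  have [h1|hN1] := subgroup_expr_det H_subgroup H_SL' H_ho prim_d; last first.
    exact: isoC_subgroup H_subgroup H_SL' H_ho det_H prim_d hN1.
  have detN : \det (- ho) = \det ho by rewrite -mulN1r detM det_mx2N1 mul1r.
  have H_Nho : H (- ho).
    have [_ _ _ HM _] := H_subgroup; rewrite -mulN1r; apply: HM => //.
    by have [|//] := (H_SL' (-1)).2; exists 1.
  apply: (isoC_subgroup H_subgroup H_SL' H_Nho); rewrite ?detN //.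
  by rewrite exprNn h1 mulr1 !exprS expr0 mulr1 mulrNN mulN1r mulr1.
- have prim_d := prim_root4 d4.
  have R_gauss := eq_gaussian_integers R_ring R_int Rd d4.
  have Ri : R 'i%C by rewrite R_gauss; exists 0, 1; rewrite add0r mul1r.
  have prim_i := prim_root4 (@sqr_i_C F).
  have [h1|hN1] := subgroup_expr_det H_subgroup H_SL' H_ho prim_d.
    exists 5; split=> //.
    have [GLh eig dG isoG subG] := dprod_model R_ring (isT : (1 < 4)%N) Ri prim_i.
    eexists; split; first exact: subG.
      by exists (mx2 'i%C 0 0 1); apply: And5 R_gauss GLh eig dG isoG.
    apply: isomorphic_isoCxC isoG.
    exact: isoCxC_subgroup H_subgroup H_SL' H_ho det_H prim_d isT h1.
  have [h [GLh eig subG isoG]] := cyc8_model R_ring Ri; exists 4; split=> //.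
  exists (cyc h); split; first exact: subG.
    by exists h; apply: And5 R_gauss GLh eig erefl isoG.
  apply: isomorphic_isoC isoG.
  exact: isoC_subgroup H_subgroup H_SL' H_ho det_H prim_d hN1.
have prim_d := prim_root6 d6.
have Nd3 : (- \det ho) ^+ 2 + - \det ho + 1 = 0 by rewrite sqrrN.
have R_eis := eq_quad_integers_3 R_ring R_int (subringN R_ring Rd) Nd3.
(* If ho ^+ 6 = -1, then ho ^+ 3 has determinant -1 and square -1. *)
have [h1|hN1] := subgroup_expr_det H_subgroup H_SL' H_ho prim_d; last first.
  have [_ _ _ HM _] := H_subgroup.
  have H_ho3 : H (ho ^+ 3).
    by rewrite !exprS expr0 mulr1; apply: (HM _ _ H_ho); apply: HM.
  have c2 : (ho ^+ 3) 0 0 ^+ 2 = -1.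
    apply: scalar_of_sqrN1; first by rewrite det_exprn (quad6_cube d6).
    by rewrite -(exprM ho 3 2) hN1.
  have [R_ho3 _] := H_GL _ H_ho3.
  by case: (not_sqrN1_and_quad_3 R_ring R_int (R_ho3 0 0) c2 Rd d6).
exists 7; split=> //; pose z : F[i] := cis (pi / 3%:R).
have z6 : z ^+ 2 - z + 1 = 0 := cis_pi3 F.
have Rz : R z := subring_quad6 R_ring Rd d6 z6.
have [GLh eig dG isoG subG] := dprod_model R_ring (isT : (1 < 6)%N) Rz (prim_root6 z6).
eexists; split; first exact: subG.
  by exists (mx2 z 0 0 1); apply: And5 R_eis GLh _ dG isoG; constructor 2.
apply: isomorphic_isoCxC isoG.
exact: isoCxC_subgroup H_subgroup H_SL' H_ho det_H prim_d isT h1.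
Qed.
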